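(* Let $\{t_n\}_{n\in\mathbb{N}}\subset\mathbb{C}$ be a sequence with $\lim_{n\to\infty}|t_n|=\infty$ and let $\{c_n\}_{n\in\mathbb{N}}$ be a sequence of real numbers such that $$c_n>0\ \text{ and }\ |\arg t_n|<\frac{\pi}{4}\quad\text{for all } n\in\mathbb{N},$$ $$\sum_{n=1}^{\infty}\frac{c_n}{|t_n|}<+\infty,\qquad \sum_{n=1}^{\infty}\frac{1}{|t_n|}<+\infty .$$ Then the meromorphic function $f(z)=\sum_{n=1}^{\infty}\frac{c_n}{z-t_n}$ has at least one zero in $\mathbb{C}$.
   Context: $\arg$ denotes the principal argument, with values in $(-\pi,\pi]$; all $t_n$ are nonzero. Since $\sum_n c_n/|t_n|<+\infty$, the series defining $f$ converges absolutely and uniformly on compact subsets of $\mathbb{C}\setminus\{t_n\}_{n\in\mathbb{N}}$ and defines a meromorphic function in $\mathbb{C}$. *)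

(* Defs.v *)
From HB Require Import structures.
From mathcomp Require Import all_boot all_order all_algebra.
From mathcomp Require Import complex.
From mathcomp Require Import all_classical all_reals all_analysis.

Set Implicit Arguments.
Unset Strict Implicit.
Unset Printing Implicit Defensive.

Import Order.TTheory GRing.Theory Num.Theory.
Import numFieldNormedType.Exports.

Local Open Scope classical_set_scope.
Local Open Scope ring_scope.
Local Open Scope complex_scope.

(* The modulus as an element of R; the library's `|z| lives in R[i]. *)
Definition cmod (R : realType) (z : R[i]) : R := ComplexField.Normc.normc z.

Lemma cmodE (R : realType) (z : R[i]) : `|z| = (cmod z)%:C.
Proof. by []. Qed.

(* Principal argument; specified by [Arg_bounds], [Arg_polar] and [Arg_unique].
   The value at 0 is irrelevant. *)
Definition Arg (R : realType) (z : R[i]) : R :=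
  if 0 <= complex.Im z then acos (complex.Re z / cmod z)
  else - acos (complex.Re z / cmod z).

Section ArgSpec.
Variable R : realType.
Implicit Types (z : R[i]) (a : R).

Let cmod_gt0 z : z != 0 -> 0 < cmod z.
Proof. by move=> z0; rewrite -ltcR -cmodE normr_gt0. Qed.

Let cmod_sqr z : cmod z ^+ 2 = complex.Re z ^+ 2 + complex.Im z ^+ 2.
Proof. by case: z => a b; rewrite /cmod /= sqr_sqrtr ?addr_ge0 ?sqr_ge0. Qed.

Let cos_bnd z : z != 0 -> -1 <= complex.Re z / cmod z <= 1.
Proof.
move=> z0; rewrite -ler_norml -(@ler_pXn2r _ 2) ?nnegrE ?normr_ge0 //.
rewrite expr1n real_normK ?num_real // expr_div_n ler_pdivrMr ?exprn_gt0 ?cmod_gt0 //.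
by rewrite mul1r cmod_sqr lerDl sqr_ge0.
Qed.

Let sin_acos_arg z : z != 0 ->
  sin (acos (complex.Re z / cmod z)) = `|complex.Im z| / cmod z.
Proof.
move=> z0; rewrite sin_acos ?cos_bnd //.
have m0 := cmod_gt0 z0.
have -> : 1 - (complex.Re z / cmod z) ^+ 2 = (`|complex.Im z| / cmod z) ^+ 2.
  rewrite !expr_div_n real_normK ?num_real //.
  rewrite -[1](@mulfV _ (cmod z ^+ 2)) ?expf_neq0 ?gt_eqF //.
  by rewrite -mulrBl {1}cmod_sqr addrAC subrr add0r.
by rewrite sqrtr_sqr ger0_norm // divr_ge0 // ltW.
Qed.

Lemma Arg_bounds z : z != 0 -> - pi < Arg z <= pi.
Proof.
move=> z0; rewrite /Arg; have b := cos_bnd z0.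
have p0 : 0 < pi :> R := pi_gt0 R.
have a0 := acos_ge0 b; have api := acos_lepi b.
case: ifPn => [_|]; first by rewrite api (lt_le_trans _ a0)// oppr_lt0.
rewrite -ltNge => im0; rewrite ltrN2; apply/andP; split; last first.
  by rewrite (le_trans _ (ltW p0)) // oppr_le0.
rewrite lt_neqAle api andbT; apply/eqP => e.
have := sin_acos_arg z0; rewrite e sinpi => /esym/eqP.
by rewrite mulf_eq0 invr_eq0 normr_eq0 (lt_eqF im0) (gt_eqF (cmod_gt0 z0)).
Qed.

Lemma Arg_polar z : z != 0 ->
  z = (cmod z * cos (Arg z)) +i* (cmod z * sin (Arg z)).
Proof.
move=> z0; have m0 : cmod z != 0 by rewrite gt_eqF ?cmod_gt0.
have cK : cos (acos (complex.Re z / cmod z)) = complex.Re z / cmod z.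
  by rewrite acosK // in_itv /= cos_bnd.
have sK := sin_acos_arg z0.
rewrite /Arg; case: ifPn => [im0|]; last rewrite -ltNge => im0.
  rewrite cK sK ger0_norm // !(mulrC (cmod z)) !divfK //.
  by case: (z).
rewrite cosN sinN cK sK ltr0_norm // mulNr opprK !(mulrC (cmod z)) !divfK //.
by case: (z).
Qed.

Lemma Arg_unique z a : z != 0 -> - pi < a <= pi ->
  z = (cmod z * cos a) +i* (cmod z * sin a) -> Arg z = a.
Proof.
move=> z0 /andP[pa ap] e; have m0 := cmod_gt0 z0.
have mn : cmod z != 0 by rewrite gt_eqF.
have eR : complex.Re z / cmod z = cos a.
  by rewrite {1}e /= mulrAC mulfV // mul1r.
have eI : complex.Im z = cmod z * sin a by rewrite {1}e.
rewrite /Arg eR eI pmulr_rge0 //.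
have [a0|a0] := leP 0 a.
  by rewrite sin_ge0_pi ?cosK ?in_itv /= ?a0.
have sa : sin a < 0.
  by rewrite -[a]opprK sinN oppr_lt0 sin_gt0_pi // oppr_gt0 a0 ltrNl.
rewrite leNgt sa /= -cosN cosK ?opprK // in_itv /= oppr_ge0 (ltW a0).
by rewrite lerNl ltW.
Qed.

End ArgSpec.

(* The topology of C is the one of the normed module (R[i])^o. *)
Definition cauchy_series (R : realType) (c : nat -> R) (t : nat -> R[i])
    (z : R[i]) : nat -> (R[i])^o :=
  series (fun n => (c n)%:C / (z - t n) : (R[i])^o).

(* f(z) = \sum_n c_n / (z - t_n), meaningful for z outside {t_n}. *)
Definition cauchy_sum (R : realType) (c : nat -> R) (t : nat -> R[i])
    (z : R[i]) : R[i] :=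
  limn (cauchy_series c t z).

(* When every c_n is positive, every t_n is a pole of f even if t has repeated
   values, so zeros of f lie outside {t_n}. The first two conjuncts rule out the
   junk values of x / 0 and of the limit of a divergent sequence. *)
Definition cauchy_zero (R : realType) (c : nat -> R) (t : nat -> R[i])
    (z : R[i]) : Prop :=
  [/\ forall n, z != t n, cvgn (cauchy_series c t z) & cauchy_sum c t z = 0].

(* Main.v *)
(** Suppose first that the zeros of the partial sums f_N leave every compact set. Partial
    fractions give f_N(-x) P_N(x) = f_N(0) Q_N(x) for x >= 0, where P_N(x) is the product of
    the 1 + x/s over the distinct poles s, and Q_N(x) that of the 1 + x/w over the zeros w,
    which lie in the same sector as the poles (Gauss-Lucas). As f_N(-x) is at least of order
    1/x and P_N has at least two factors, Q_N(x0) >= e for some x0 independent of N, so the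
    sum S_N of the Re(1/w) is at least 1/(2 x0). Hence Q_N(y) >= exp(y S_N / 2) >=
    exp(y / (4 x0)), provided that no zero has modulus at most y. For y large this
    contradicts the boundedness of f_N(-y) and f_N(0) and the subexponential growth of P_N,
    which comes from the convergence of the sum of the 1/|t_n|. So all the f_N have zeros in
    a common disc. A cluster point of such zeros is not a pole, since f_N is large near
    each t_m uniformly in N, and is therefore a zero of f. *)

Require Import Defs.
From HB Require Import structures.
From mathcomp Require Import all_boot all_order all_algebra.
From mathcomp Require Import complex ring lra.
From mathcomp Require Import all_classical all_reals all_analysis.

Set Implicit Arguments.
Unset Strict Implicit.
Unset Printing Implicit Defensive.

Import Order.TTheory GRing.Theory Num.Theory.
Import numFieldNormedType.Exports.

Local Open Scope classical_set_scope.
Local Open Scope ring_scope.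
Local Open Scope complex_scope.

(** * Factorisation of a sum of simple fractions over its poles and zeros *)

Section PartialFractions.
Variable F : closedFieldType.

(** [p] is the numerator over the common denominator. At a point of [s] all terms of [p] but one
    vanish, and that one does not, so no root of [p] lies in [s]. *)
Lemma pfrac_factor_uniq (s : seq F) (C : F -> F) :
  uniq s -> {in s, forall x, C x != 0} ->
  exists a : F, exists2 ws : seq F, {in ws, forall w, w \notin s} &
    forall z, z \notin s ->
      (\sum_(x <- s) C x / (z - x)) * \prod_(x <- s) (z - x) =
      a * \prod_(w <- ws) (z - w).
Proof.
move=> us C0.
pose p := \sum_(x <- s) C x *: \prod_(y <- s | y != x) ('X - y%:P).
have pE z : p.[z] = \sum_(x <- s) C x * \prod_(y <- s | y != x) (z - y).
  rewrite horner_sum; apply: eq_bigr => x _; rewrite hornerZ horner_prod.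
  by congr (_ * _); apply: eq_bigr => y _; rewrite hornerXsubC.
have [ws pws] := closed_field_poly_normal p.
have pE' z : p.[z] = lead_coef p * \prod_(w <- ws) (z - w).
  rewrite {1}pws hornerZ horner_prod; congr (_ * _).
  by apply: eq_bigr => y _; rewrite hornerXsubC.
exists (lead_coef p), ws => [w wws|z zs].
  apply/negP => ws'; have : p.[w] != 0.
    rewrite pE (bigD1_seq w)//= [X in _ + X]big1 => [|x xw]; last first.
      by rewrite (big_rem w)//= eq_sym xw subrr mul0r mulr0.
    rewrite addr0 mulf_neq0 ?C0// prodf_seq_neq0; apply/allP => y _.
    by apply/implyP; rewrite subr_eq0 eq_sym.
  by rewrite pE' (big_rem w)//= subrr mul0r mulr0 eqxx.
rewrite -pE' pE mulr_suml [LHS]big_seq [RHS]big_seq; apply: eq_bigr => x xs.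
rewrite (bigD1_seq x)//= mulrA divfK// subr_eq0.
by apply: contraNneq zs => ->.
Qed.

(** Equal poles are grouped: the coefficient at a pole is the sum of the [c j] over all [j] with
    [t j] equal to it, and the hypothesis keeps each pole from cancelling. *)
Lemma pfrac_factor (c t : nat -> F) (N : nat) :
  (forall k, (k < N)%N -> \sum_(0 <= j < N | t j == t k) c j != 0) ->
  exists a : F, exists2 ws : seq F, {in ws, forall w, forall k, (k < N)%N -> w != t k} &
    forall z, (forall k, (k < N)%N -> z != t k) ->
      (\sum_(0 <= k < N) c k / (z - t k)) * \prod_(x <- undup (mkseq t N)) (z - x) =
      a * \prod_(w <- ws) (z - w).
Proof.
move=> C0; set s := undup _.
have sP z : reflect (forall k, (k < N)%N -> z != t k) (z \notin s).
  rewrite mem_undup; apply: (iffP idP) => [zN k kN|zt].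
    by apply: contraNneq zN => ->; apply: map_f; rewrite mem_iota.
  apply/mapP => -[k]; rewrite mem_iota => kN ez.
  by have := zt k kN; rewrite ez eqxx.
have [|x|a [ws wss E]] := @pfrac_factor_uniq s (fun x => \sum_(0 <= j < N | t j == x) c j).
- exact: undup_uniq.
- by rewrite mem_undup => /mapP[k]; rewrite mem_iota => kN ->; exact: C0.
exists a, ws => [w /wss/sP//|z /sP zs].
rewrite -E//; congr (_ * _).
under [RHS]eq_bigr do rewrite mulr_suml.
rewrite (exchange_big_dep xpredT)//= big_nat [RHS]big_nat.
apply: eq_bigr => k kN; rewrite big_mkcond (bigD1_seq (t k)) ?undup_uniq//=.
  by rewrite eqxx big1 ?addr0// => x; rewrite eq_sym => /negPf->.
by rewrite mem_undup map_f ?mem_iota.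
Qed.

(** Comparing with the values at 0 eliminates the leading coefficient and leaves the normalised
    products P_N and Q_N. *)
Lemma pfrac_factor0 (c t : nat -> F) (N : nat) :
  (forall k, (k < N)%N -> t k != 0) ->
  (forall k, (k < N)%N -> \sum_(0 <= j < N | t j == t k) c j != 0) ->
  \sum_(0 <= k < N) c k / (0 - t k) != 0 ->
  exists2 ws : seq F,
    {in ws, forall w, [/\ w != 0, forall k, (k < N)%N -> w != t k &
                      \sum_(0 <= k < N) c k / (w - t k) = 0]} &
    forall z, (forall k, (k < N)%N -> z != t k) ->
      (\sum_(0 <= k < N) c k / (z - t k)) *
        \prod_(x <- undup (mkseq t N)) (1 - z / x) =
      (\sum_(0 <= k < N) c k / (0 - t k)) * \prod_(w <- ws) (1 - z / w).
Proof.
move=> t0 C0 f0; have [a [ws wst E]] := pfrac_factor C0.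
have s0 x : x \in undup (mkseq t N) -> x != 0.
  by rewrite mem_undup => /mapP[k]; rewrite mem_iota => kN ->; exact: t0.
(* At a root of the numerator the product over the poles is nonzero, so the sum itself vanishes. *)
have ws0 w : w \in ws -> \sum_(0 <= k < N) c k / (w - t k) = 0.
  move=> wws; have := E w (wst w wws).
  rewrite [X in _ = _ * X](big_rem w)//= subrr mul0r mulr0 => /eqP.
  rewrite mulf_eq0 => /orP[/eqP//|]; rewrite prodf_seq_eq0 => /hasP[x].
  rewrite mem_undup => /mapP[k]; rewrite mem_iota => kN -> /=.
  by rewrite subr_eq0 (negPf (wst w wws k kN)).
have wn0 w : w \in ws -> w != 0.
  by move=> /ws0; apply: contra_eq_neq => ->.
have prodB0 (s : seq F) z : {in s, forall x, x != 0} ->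
    \prod_(x <- s) (z - x) = \prod_(x <- s) (0 - x) * \prod_(x <- s) (1 - z / x).
  move=> sn0; rewrite -big_split/= !big_seq; apply: eq_bigr => x /sn0 x0.
  by rewrite sub0r mulrBr mulr1 mulNr mulrCA divff// mulr1 opprK addrC.
exists ws => [w wws|z zt].
  by split; [exact: wn0|exact: wst|exact: ws0].
have p0 : \prod_(x <- undup (mkseq t N)) (0 - x) != 0.
  rewrite prodf_seq_neq0; apply/allP => x /s0 x0.
  by rewrite /= sub0r oppr_eq0.
apply: (mulfI p0); rewrite mulrCA -prodB0// (E _ zt) (prodB0 ws)//.
rewrite mulrA -(E 0); first by ring.
by move=> k kN; rewrite eq_sym t0.
Qed.

End PartialFractions.


(** * The modulus, and the sector containing the poles *)

Section Modulus.
Variable R : realType.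
Implicit Types z w : R[i].

Lemma cmod_ge0 z : 0 <= cmod z.
Proof. by case: z => a b; exact: sqrtr_ge0. Qed.

Lemma cmod_gt0 z : (0 < cmod z) = (z != 0).
Proof. by rewrite -ltcR -cmodE normr_gt0. Qed.

Lemma cmod_sqr z : cmod z ^+ 2 = complex.Re z ^+ 2 + complex.Im z ^+ 2.
Proof. by case: z => a b; rewrite /cmod /= sqr_sqrtr ?addr_ge0 ?sqr_ge0. Qed.

Lemma cmodM z w : cmod (z * w) = cmod z * cmod w.
Proof. exact: ComplexField.Normc.normcM. Qed.

Lemma cmodV z : cmod z^-1 = (cmod z)^-1.
Proof. exact: ComplexField.Normc.normcV. Qed.

Lemma cmod1 : cmod (1 : R[i]) = 1.
Proof. exact: ComplexField.Normc.normc1. Qed.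

Lemma cmod0 : cmod (0 : R[i]) = 0.
Proof. exact: ComplexField.Normc.normc0. Qed.

Lemma cmodN z : cmod (- z) = cmod z.
Proof. exact: normcN. Qed.

Lemma cmodB z w : cmod (z - w) = cmod (w - z).
Proof. by rewrite -opprB cmodN. Qed.

Lemma cmodR (a : R) : cmod a%:C = `|a|.
Proof. by rewrite /cmod /= expr0n addr0 sqrtr_sqr. Qed.

Lemma ler_cmodD z w : cmod (z + w) <= cmod z + cmod w.
Proof. exact: le_normcD. Qed.

Lemma ler_distcmodD w z v : cmod (z - v) <= cmod (z - w) + cmod (w - v).
Proof. by rewrite -[z - v](subrKA w) ler_cmodD. Qed.

Lemma cmod_sum (I : Type) (s : seq I) (P : pred I) (F : I -> R[i]) :
  cmod (\sum_(i <- s | P i) F i) <= \sum_(i <- s | P i) cmod (F i).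
Proof.
elim/big_rec2: _ => [|i y x _ le_yx]; first by rewrite cmod0.
by rewrite (le_trans (ler_cmodD _ _))// lerD2l.
Qed.

Lemma cmod_prod (I : Type) (s : seq I) (P : pred I) (F : I -> R[i]) :
  cmod (\prod_(i <- s | P i) F i) = \prod_(i <- s | P i) cmod (F i).
Proof. exact: (big_morph _ cmodM cmod1). Qed.

Lemma Re_sum (I : Type) (s : seq I) (P : pred I) (F : I -> R[i]) :
  complex.Re (\sum_(i <- s | P i) F i) = \sum_(i <- s | P i) complex.Re (F i).
Proof. by apply: (big_morph (@complex.Re R)) => // -[a b] [c d]. Qed.

Lemma Im_sum (I : Type) (s : seq I) (P : pred I) (F : I -> R[i]) :
  complex.Im (\sum_(i <- s | P i) F i) = \sum_(i <- s | P i) complex.Im (F i).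
Proof. by apply: (big_morph (@complex.Im R)) => // -[a b] [c d]. Qed.

Lemma Re_complexB z w : complex.Re (z - w) = complex.Re z - complex.Re w.
Proof. by case: z; case: w. Qed.

Lemma Im_complexB z w : complex.Im (z - w) = complex.Im z - complex.Im w.
Proof. by case: z; case: w. Qed.

Lemma Re_complexMr (a : R) z : complex.Re (a%:C * z) = a * complex.Re z.
Proof. by case: z => x y /=; rewrite mul0r subr0. Qed.

Lemma Im_complexMr (a : R) z : complex.Im (a%:C * z) = a * complex.Im z.
Proof. by case: z => x y /=; rewrite mul0r addr0. Qed.

Lemma Re_complexV z : complex.Re z^-1 = complex.Re z / cmod z ^+ 2.
Proof. by rewrite cmod_sqr; case: z. Qed.

Lemma Im_complexV z : complex.Im z^-1 = - complex.Im z / cmod z ^+ 2.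
Proof. by rewrite cmod_sqr; case: z => a b /=; rewrite mulNr. Qed.

Lemma ler_Re_cmod z : `|complex.Re z| <= cmod z.
Proof.
by rewrite -(@ler_pXn2r _ 2) ?nnegrE ?cmod_ge0// real_normK ?num_real// cmod_sqr lerDl sqr_ge0.
Qed.

Lemma ler_Im_cmod z : `|complex.Im z| <= cmod z.
Proof.
by rewrite -(@ler_pXn2r _ 2) ?nnegrE ?cmod_ge0// real_normK ?num_real// cmod_sqr lerDr sqr_ge0.
Qed.

Lemma cmod_ler_ReIm z : cmod z <= `|complex.Re z| + `|complex.Im z|.
Proof.
rewrite -(@ler_pXn2r _ 2) ?nnegrE ?cmod_ge0 ?addr_ge0// cmod_sqr.
rewrite sqrrD !real_normK ?num_real//.
have := normr_ge0 (complex.Re z); have := normr_ge0 (complex.Im z); nra.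
Qed.

(** The open sector |arg z| < pi/4 in Cartesian form, which makes its stability under inversion and
    under adding nonnegative reals easy to check. *)
Definition wedge z := `|complex.Im z| < complex.Re z.

Lemma wedge_neq0 z : wedge z -> z != 0.
Proof. by rewrite /wedge; apply: contraTneq => ->; rewrite normr0 ltxx. Qed.

Lemma wedge_Re_gt0 z : wedge z -> 0 < complex.Re z.
Proof. by apply: le_lt_trans. Qed.

Lemma wedgeV z : wedge z -> wedge z^-1.
Proof.
move=> wz; have z0 := wedge_neq0 wz.
have m0 : 0 < (cmod z ^+ 2)^-1 by rewrite invr_gt0 exprn_gt0// cmod_gt0.
by rewrite /wedge Re_complexV Im_complexV normrM normrN (gtr0_norm m0) ltr_pM2r.
Qed.

(** For |a| < pi/4 one has |sin a| < sin(pi/4) = cos(pi/4) < cos a. *)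
Lemma wedge_Arg z : z != 0 -> `|Arg z| < pi / 4 -> wedge z.
Proof.
move=> z0 az; have m0 : 0 < cmod z by rewrite cmod_gt0.
have p0 := pi_gt0 R.
have p2 : pi / 4 < pi / 2 :> R by lra.
have p2' : cos (pi / 4) = sin (pi / 4) :> R.
  by rewrite -cosN -cosBpihalf; congr cos; field.
have ca : cos (pi / 4) < cos (Arg z).
  by rewrite -[cos (Arg z)]cos_norm ltr_cos// in_itv /=;
    apply/andP; split=> //; have := normr_ge0 (Arg z); lra.
have sa : `|sin (Arg z)| < sin (pi / 4).
  move: az; rewrite !ltr_norml => /andP[az za].
  by rewrite -sinN !ltr_sin ?az ?za// in_itv /=; apply/andP; split; lra.
rewrite /wedge (Arg_polar z0) /= normrM (gtr0_norm m0) ltr_pM2l//; lra.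
Qed.

(* If w lies outside one of the two half-planes whose intersection is the wedge, all terms
   of the sum lie strictly on one side of a line, as in the Gauss-Lucas theorem. *)
Lemma wedge_zero (c : nat -> R) (t : nat -> R[i]) (N : nat) w : (0 < N)%N ->
  (forall k, 0 < c k) -> (forall k, wedge (t k)) ->
  \sum_(0 <= k < N) (c k)%:C / (w - t k) = 0 -> wedge w.
Proof.
move=> N0 c0 wt f0.
suff H (s : R) : `|s| = 1 -> s * complex.Im w < complex.Re w.
  have := H 1 (normr1 _); have := H (-1) (normrN1 _).
  by rewrite /wedge ltr_norml; lra.
move=> s1; rewrite ltNge; apply/negP => le_w.
have st k : s * complex.Im (t k) < complex.Re (t k).
  rewrite (le_lt_trans (ler_norm _))// normrM s1 mul1r; exact: wt.
have wk k : 0 < cmod (w - t k) ^+ 2.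
  rewrite exprn_gt0// cmod_gt0 subr_eq0; apply: contraTneq le_w => ->.
  by rewrite -ltNge.
suff : complex.Re (\sum_(0 <= k < N) (c k)%:C / (w - t k))
     + s * complex.Im (\sum_(0 <= k < N) (c k)%:C / (w - t k)) < 0.
  by rewrite f0 /= mulr0 addr0 ltxx.
rewrite Re_sum Im_sum mulr_sumr -big_split/= -oppr_gt0 -sumrN.
rewrite big_mkord; have : (\sum_(i < N) (0:R)) = 0 by rewrite big1.
move=> {1}<-; apply: ltr_sum => [|i _]; last first.
  rewrite Re_complexMr Im_complexMr Re_complexV Im_complexV Re_complexB Im_complexB.
  have := wk i; have := st i; have := c0 i; move: (cmod _ ^+ 2) => m ci si mi.
  rewrite oppr_gt0.
  have -> : c i * ((complex.Re w - complex.Re (t i)) / m) +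
     s * (c i * (- (complex.Im w - complex.Im (t i)) / m)) =
    - (c i / m * ((complex.Re (t i) - s * complex.Im (t i)) - (complex.Re w - s * complex.Im w))).
    by field; rewrite gt_eqF.
  by rewrite oppr_lt0 mulr_gt0 ?divr_gt0//; lra.
by apply/hasP; exists (Ordinal N0); rewrite ?mem_index_enum.
Qed.

End Modulus.

(** * Bounds on the factors 1 + x/w for w in the sector *)

Section ProductBounds.
Variable R : realType.
Implicit Types (x y : R) (w : R[i]).

Lemma ler_prod_undup (T : eqType) (s : seq T) (G : T -> R) :
  (forall a, 1 <= G a) -> \prod_(a <- undup s) G a <= \prod_(a <- s) G a.
Proof.
move=> G1; have G0 r : 0 <= \prod_(a <- r) G a.
  by apply: prodr_ge0 => a _; rewrite (le_trans _ (G1 a)).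
elim: s => //= a s ih; case: ifP => _; rewrite !big_cons.
  by rewrite (le_trans ih)// ler_peMl.
by rewrite ler_wpM2l// (le_trans _ (G1 a)).
Qed.

Lemma ler_prod2 (T : eqType) (s : seq T) (G : T -> R) (a b : T) :
  {in s, forall e, 1 <= G e} -> uniq s -> a \in s -> b \in s -> a != b ->
  G a * G b <= \prod_(e <- s) G e.
Proof.
move=> G1 us sa sb ab; have G0 e : e \in s -> 0 <= G e.
  by move=> /G1; apply: le_trans.
rewrite (big_rem a)//= ler_wpM2l ?G0//.
have br : b \in rem a s by rewrite mem_rem_uniq// inE eq_sym ab.
rewrite (big_rem b)//= ler_peMr ?G0//.
rewrite big_seq; elim/big_ind : _ => // [u v u1 v1|e er]; first by rewrite mulr_ege1.
exact/G1/(mem_rem (mem_rem er)).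
Qed.

Lemma wedge_Dr x w : 0 <= x -> wedge w -> wedge (x%:C + w).
Proof.
case: w => a b x0; rewrite /wedge /= add0r => h.
by rewrite (lt_le_trans h)// lerDr.
Qed.

Lemma cmod_Dr_ge x w : 0 <= x -> wedge w -> cmod w <= cmod (x%:C + w).
Proof.
move=> x0 /wedge_Re_gt0.
rewrite -(@ler_pXn2r _ 2) ?nnegrE ?cmod_ge0// !cmod_sqr.
case: w => a b /= a0; nra.
Qed.

Lemma cmod_Dr_ge_r x w : 0 <= x -> wedge w -> x <= cmod (x%:C + w).
Proof.
move=> x0 /wedge_Re_gt0 w0; rewrite (le_trans _ (ler_Re_cmod _))//.
by rewrite (le_trans _ (ler_norm _))//; case: w w0 => a b /= a0; lra.
Qed.

Lemma cmod_factor x w : w != 0 ->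
  cmod (1 - (- x)%:C / w) = cmod (x%:C + w) / cmod w.
Proof.
move=> w0; rewrite -cmodV -cmodM; congr cmod.
by rewrite rmorphN/= mulNr opprK mulrDl divff// addrC.
Qed.

Lemma cmod_factor_ge1 x w : 0 <= x -> wedge w -> 1 <= cmod (1 - (- x)%:C / w).
Proof.
move=> x0 ww; have w0 := wedge_neq0 ww.
by rewrite cmod_factor// ler_pdivlMr ?cmod_gt0// mul1r cmod_Dr_ge.
Qed.

Lemma cmod_factor_ge x w : 0 <= x -> wedge w ->
  x / cmod w <= cmod (1 - (- x)%:C / w).
Proof.
move=> x0 ww; have w0 := wedge_neq0 ww.
by rewrite cmod_factor// ler_pM2r ?invr_gt0 ?cmod_gt0// cmod_Dr_ge_r.
Qed.

Lemma cmod_factor_le x w : 0 <= x -> cmod (1 - (- x)%:C / w) <= 1 + x / cmod w.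
Proof.
move=> x0; rewrite (le_trans (ler_cmodD _ _))// cmod1 lerD2l.
by rewrite cmodN cmodM cmodV cmodR normrN ger0_norm.
Qed.

(** In the sector |1/w| <= |Re(1/w)| + |Im(1/w)| <= 2 Re(1/w); then 1 + u <= exp(u) applies. *)
Lemma cmod_factor_le_expR x w : 0 <= x -> wedge w ->
  cmod (1 - (- x)%:C / w) <= expR (2 * x * complex.Re w^-1).
Proof.
move=> x0 ww; rewrite (le_trans (cmod_factor_le _ x0))//.
rewrite (le_trans _ (expR_ge1Dx _))// lerD2l (mulrC 2) -mulrA ler_wpM2l//.
rewrite -cmodV (le_trans (cmod_ler_ReIm _))//.
have := wedgeV ww; rewrite /wedge => h.
by rewrite gtr0_norm ?(wedge_Re_gt0 (wedgeV ww))//; lra.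
Qed.

(** With y = x Re(1/w), the real part of the factor is 1 + y, and x <= |w| gives y <= 1, where
    exp(y/2) <= 1 + y. *)
Lemma cmod_factor_ge_expR x w : 0 <= x <= cmod w -> wedge w ->
  expR (x / 2 * complex.Re w^-1) <= cmod (1 - (- x)%:C / w).
Proof.
move=> /andP[x0 xw] ww; have r0 := wedge_Re_gt0 (wedgeV ww).
have w0 : 0 < cmod w by rewrite cmod_gt0 wedge_neq0.
have xr1 : x * complex.Re w^-1 <= 1.
  rewrite (@le_trans _ _ (x / cmod w))// ?ler_pdivrMr ?mul1r//.
  by rewrite ler_wpM2l// -cmodV (le_trans (ler_norm _))// ler_Re_cmod.
rewrite (@le_trans _ _ (1 + x * complex.Re w^-1))//.
  have xr0 : 0 <= x * complex.Re w^-1 by rewrite mulr_ge0// ltW.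
  rewrite mulrAC; move: (x * _) xr0 xr1 => y y0 y1.
  (* Hence exp(y/2) (1 - y/2) <= 1, while (1 + y)(1 - y/2) >= 1 for 0 <= y <= 1. *)
  have h : 1 - y / 2 <= expR (- (y / 2)) by exact: expR_ge1Dx.
  have e0 := expR_gt0 (y / 2).
  have := expRxMexpNx_1 (y / 2); nra.
rewrite (le_trans _ (ler_Re_cmod _))// (le_trans _ (ler_norm _))//.
rewrite rmorphN/= mulNr opprK; case: (w^-1) => a b /=.
by rewrite mul0r subr0.
Qed.

End ProductBounds.

(** * Zeros of the partial sums in a common disc *)

Section ZerosOfPartialSums.
Variables (R : realType) (c : nat -> R) (t : nat -> R[i]).
Hypothesis c_gt0 : forall k, 0 < c k.
Hypothesis t_wedge : forall k, wedge (t k).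

Local Notation f N z := (\sum_(0 <= k < N) (c k)%:C / (z - t k)).
Local Notation P N x :=
  (\prod_(s <- undup (mkseq t N)) (1 - (- x)%:C / s)).

(** Moving from 0 to -x increases the distance to every pole of the sector. *)
Lemma pfrac_neg_le (N : nat) (x : R) : 0 <= x ->
  cmod (f N (- x)%:C) <= \sum_(0 <= k < N) c k / cmod (t k).
Proof.
move=> x0; rewrite (le_trans (cmod_sum _ _ _))// ler_sum// => k _.
rewrite cmodM cmodV cmodR gtr0_norm// ler_wpM2l ?(ltW (c_gt0 k))//.
have tk := t_wedge k; rewrite rmorphN/= -opprD cmodN lef_pV2 ?posrE ?cmod_gt0.
- exact: cmod_Dr_ge.
- exact/wedge_neq0/wedge_Dr.
- exact: wedge_neq0.
Qed.

(** All terms of -f_N(-x) have positive real part, so the first one alone bounds the sum from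
    below. *)
Lemma pfrac_neg_ge (N : nat) (x : R) : (0 < N)%N -> 0 <= x ->
  c 0%N * complex.Re (x%:C + t 0%N)^-1 <= cmod (f N (- x)%:C).
Proof.
move=> N0 x0; rewrite (le_trans _ (ler_Re_cmod _))// -normrN.
rewrite (le_trans _ (ler_norm _))// Re_sum -sumrN.
rewrite (eq_bigr (fun k => c k * complex.Re (x%:C + t k)^-1)) => [|k _].
  rewrite big_ltn// lerDl; apply: sumr_ge0 => k _.
  by rewrite mulr_ge0 ?ltW// wedge_Re_gt0//; exact/wedgeV/wedge_Dr.
rewrite Re_complexMr -mulrN; congr (_ * _).
by rewrite rmorphN/= -opprD invrN; case: (_^-1) => a b /=; rewrite opprK.
Qed.

Lemma pfrac0_ge (N : nat) : (0 < N)%N ->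
  c 0%N * complex.Re (t 0%N)^-1 <= cmod (f N 0).
Proof. by move=> N0; have := @pfrac_neg_ge N 0 N0 (lexx _); rewrite oppr0 add0r. Qed.

(** Repeated poles may be counted in the majorant, since its factors are at least 1. *)
Lemma factor_prod_le (N : nat) (x : R) : 0 <= x ->
  cmod (P N x) <= \prod_(0 <= k < N) (1 + x / cmod (t k)).
Proof.
move=> x0; rewrite cmod_prod.
have -> : \prod_(0 <= k < N) (1 + x / cmod (t k)) =
    \prod_(s <- mkseq t N) (1 + x / cmod s).
  by rewrite big_map /index_iota subn0.
apply: le_trans (ler_prod_undup _ _); last first.
  by move=> s; rewrite lerDl divr_ge0// cmod_ge0.
by apply: ler_prod => s _; rewrite cmod_ge0 cmod_factor_le.
Qed.

(** Two distinct poles give quadratic growth in x, which outweighs the decay of order 1/x of the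
    lower bound for f_N(-x). *)
Lemma factor_prod_ge (N m : nat) (x : R) : 0 <= x -> (m < N)%N -> t 0%N != t m ->
  x / cmod (t 0%N) * (x / cmod (t m)) <= cmod (P N x).
Proof.
move=> x0 mN tm; rewrite cmod_prod.
have inT k : (k < N)%N -> t k \in undup (mkseq t N).
  by move=> kN; rewrite mem_undup map_f// mem_iota.
apply: (@le_trans _ _ (cmod (1 - (- x)%:C / t 0%N) * cmod (1 - (- x)%:C / t m))).
  by rewrite ler_pM ?divr_ge0 ?cmod_ge0// cmod_factor_ge.
apply: (ler_prod2 (G := fun s => cmod (1 - (- x)%:C / s))) => //.
- move=> s; rewrite mem_undup => /mapP[k _ ->]; exact: cmod_factor_ge1.
- exact: undup_uniq.
- by apply: inT; exact: leq_ltn_trans mN.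
- exact: inT.
Qed.

(** Positivity of the [c k] keeps the coefficients of repeated poles from cancelling, and the sector
    condition makes f_N(0) nonzero. *)
Lemma pfrac_factor_wedge (N : nat) : (0 < N)%N ->
  exists2 ws : seq R[i],
    {in ws, forall w, [/\ wedge w, forall k, (k < N)%N -> w != t k & f N w = 0]} &
    forall x, 0 <= x -> cmod (f N (- x)%:C) * cmod (P N x) =
      cmod (f N 0) * \prod_(w <- ws) cmod (1 - (- x)%:C / w).
Proof.
move=> N0; have t0 k : (k < N)%N -> t k != 0 by move=> _; exact: wedge_neq0.
have g0 : 0 < c 0%N * complex.Re (t 0%N)^-1.
  by rewrite mulr_gt0//; exact/wedge_Re_gt0/wedgeV.
have f0 : f N 0 != 0 by rewrite -cmod_gt0 (lt_le_trans g0)// pfrac0_ge.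
have C0 k : (k < N)%N -> \sum_(0 <= j < N | t j == t k) (c j)%:C != 0.
  move=> kN; rewrite -rmorph_sum/= -cmod_gt0 cmodR normr_gt0 gt_eqF//.
  rewrite big_mkord (bigD1 (Ordinal kN))//= ltr_wpDr//.
  by apply: sumr_ge0 => j _; exact: ltW.
have [ws wsP E] := pfrac_factor0 t0 C0 f0.
exists ws => [w /wsP[_ wt fw0]|x x0].
  by split=> //; exact: wedge_zero fw0.
rewrite -cmodM E ?cmodM ?cmod_prod// => k kN.
rewrite rmorphN/= -subr_eq0 -opprD oppr_eq0.
exact/wedge_neq0/wedge_Dr.
Qed.

Lemma bounded_zeros (m : nat) (A : R) : t 0%N != t m ->
  (forall N, \sum_(0 <= k < N) c k / cmod (t k) <= A) ->
  (forall e, 0 < e -> exists K, forall N x, 0 <= x ->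
     \prod_(0 <= k < N) (1 + x / cmod (t k)) <= K * expR (e * x)) ->
  exists r, forall N, (m < N)%N -> exists w,
    [/\ forall k, (k < N)%N -> w != t k, f N w = 0 & cmod w <= r].
Proof.
move=> tm sumA prodK.
have T0 : 0 < cmod (t 0%N) by rewrite cmod_gt0 wedge_neq0.
have Tm : 0 < cmod (t m) by rewrite cmod_gt0 wedge_neq0.
have A0 : 0 < A.
  by rewrite (lt_le_trans _ (sumA 1%N))// big_nat1 divr_gt0.
pose g := c 0%N * complex.Re (t 0%N)^-1.
have g0 : 0 < g by rewrite mulr_gt0//; exact/wedge_Re_gt0/wedgeV.
(* The second summand makes the lower bound of |f_N(-x0) P_N(x0)| at least e A; the first ensures
   |x0 + t_0| <= 2 x0. *)
pose x0 := cmod (t 0%N) + 4 * expR 1 * A * cmod (t 0%N) * cmod (t m) / c 0%N.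
have x0_gt0 : 0 < x0.
  by rewrite ltr_wpDr// divr_ge0 ?mulr_ge0 ?expR_ge0 ?cmod_ge0 ?ltW.
(* The rate 1/(8 x0) is half of the rate 1/(4 x0) at which Q_N will be shown to grow. *)
have [K KP] : exists K, forall N x, 0 <= x ->
     \prod_(0 <= k < N) (1 + x / cmod (t k)) <= K * expR ((8 * x0)^-1 * x).
  by apply: prodK; rewrite invr_gt0 mulr_gt0.
have K0 : 0 < K.
  have := KP 0%N 0 (lexx _); rewrite big_nil mulr0 expR0 mulr1.
  by apply: lt_le_trans.
(* Chosen so that y/(8 x0) = A K / g. *)
pose y := 8 * x0 * (A * K / g).
have y0 : 0 < y by rewrite !mulr_gt0 ?invr_gt0.
exists y => N mN; have N0 : (0 < N)%N by exact: leq_ltn_trans mN.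
have [ws wsP E] := pfrac_factor_wedge N0.
have [/hasP[w wws wy]|/hasPn ws_far] := boolP (has (fun w => cmod w <= y) ws).
  by exists w; have [_ wt fw] := wsP w wws.
exfalso.
pose S := \sum_(w <- ws) complex.Re w^-1.
have f0_le : cmod (f N 0) <= A.
  by have := pfrac_neg_le N (lexx 0); rewrite oppr0 => /le_trans -> //.
have f0_ge : g <= cmod (f N 0) by exact: pfrac0_ge.
have Q_le x : 0 <= x -> \prod_(w <- ws) cmod (1 - (- x)%:C / w) <= expR (2 * x * S).
  move=> x_ge0; rewrite /S mulr_sumr expR_sum !big_seq ler_prod// => w wws.
  by rewrite cmod_ge0 cmod_factor_le_expR//; have [] := wsP w wws.
have Q_ge : expR (y / 2 * S) <= \prod_(w <- ws) cmod (1 - (- y)%:C / w).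
  rewrite /S mulr_sumr expR_sum !big_seq ler_prod// => w wws.
  rewrite expR_ge0 cmod_factor_ge_expR//; last by have [] := wsP w wws.
  by rewrite ltW//= ltW// ltNge ws_far.
(* A e <= |f_N(-x0) P_N(x0)| = |f_N(0)| Q_N(x0) <= A exp(2 x0 S), with Q_N the product of moduli
   over [ws]. *)
have S_ge : 1 <= 2 * x0 * S.
  rewrite -ler_expR -(ler_pM2l A0).
  apply: (@le_trans _ _ (cmod (f N 0) * expR (2 * x0 * S))); last first.
    by rewrite ler_wpM2r ?expR_ge0.
  apply: (@le_trans _ _ (cmod (f N (- x0)%:C) * cmod (P N x0))); last first.
    by rewrite E ?(ltW x0_gt0)// ler_wpM2l ?cmod_ge0// Q_le// ltW.
  have t0x0 : cmod (t 0%N) <= x0.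
    by rewrite lerDl divr_ge0 ?mulr_ge0 ?expR_ge0 ?cmod_ge0 ?ltW.
  have ux0 := wedge_Dr (ltW x0_gt0) (t_wedge 0).
  (* Re(1/u) = Re(u)/|u|^2 with Re(u) >= x0 and |u| <= 2 x0. *)
  have Re_ge : (4 * x0)^-1 <= complex.Re (x0%:C + t 0%N)^-1.
    rewrite Re_complexV ler_pdivlMr ?exprn_gt0 ?cmod_gt0 ?wedge_neq0//.
    rewrite ler_pdivrMl ?mulr_gt0//.
    have h1 : x0 <= complex.Re (x0%:C + t 0%N).
      by have := wedge_Re_gt0 (t_wedge 0); case: (t 0%N) => a b /= a0; rewrite lerDl ltW.
    have h2 : cmod (x0%:C + t 0%N) <= 2 * x0.
      by rewrite (le_trans (ler_cmodD _ _))// cmodR gtr0_norm//; lra.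
    have h3 := cmod_ge0 (x0%:C + t 0%N); nra.
  apply: (@le_trans _ _ (c 0%N / (4 * x0) * (x0 / cmod (t 0%N) * (x0 / cmod (t m))))).
    have -> : c 0%N / (4 * x0) * (x0 / cmod (t 0%N) * (x0 / cmod (t m))) =
      x0 * (c 0%N / (4 * cmod (t 0%N) * cmod (t m))) by field; rewrite !gt_eqF.
    rewrite -ler_pdivrMr ?divr_gt0 ?mulr_gt0//.
    have -> : A * expR 1 / (c 0%N / (4 * cmod (t 0%N) * cmod (t m))) =
      4 * expR 1 * A * cmod (t 0%N) * cmod (t m) / c 0%N by field; rewrite !gt_eqF.
    by rewrite lerDr ltW.
  have x0_ge0 := ltW x0_gt0; have c0 := ltW (c_gt0 0).
  rewrite ler_pM ?mulr_ge0 ?divr_ge0 ?invr_ge0 ?mulr_ge0 ?cmod_ge0//.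
    by rewrite (le_trans _ (pfrac_neg_ge N0 x0_ge0))// ler_wpM2l.
  exact: factor_prod_ge.
(* Both sides bound |f_N(-y) P_N(y)| = |f_N(0)| Q_N(y); cancelling one exponential leaves exp(A K /
   g) <= A K / g, which is absurd. *)
have : g * expR (2 * ((8 * x0)^-1 * y)) <= A * (K * expR ((8 * x0)^-1 * y)).
  apply: (@le_trans _ _ (cmod (f N (- y)%:C) * cmod (P N y))); last first.
    rewrite ler_pM ?cmod_ge0//; first exact: le_trans (pfrac_neg_le _ (ltW y0)) (sumA _).
    exact: le_trans (factor_prod_le _ (ltW y0)) (KP _ _ (ltW y0)).
  rewrite E ?(ltW y0)// ler_pM ?expR_ge0 ?(ltW g0)//.
  apply: le_trans Q_ge; rewrite ler_expR.
  have -> : 2 * ((8 * x0)^-1 * y) = y / (4 * x0) by field; rewrite gt_eqF.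
  rewrite -mulrA ler_wpM2l ?(ltW y0)// -[leLHS]mul1r ler_pdivrMr ?mulr_gt0//; lra.
have -> : (8 * x0)^-1 * y = A * K / g by rewrite /y; field; rewrite !gt_eqF.
rewrite leNgt => /negP; apply.
rewrite mulr_natl mulr2n expRD !mulrA ltr_pM2r ?expR_gt0//.
by rewrite -ltr_pdivrMl// mulrC (lt_le_trans _ (expR_ge1Dx _))// ltrDr.
Qed.

End ZerosOfPartialSums.

(** * Series, subexponential products and cluster points *)

Section Series.
Variable R : realType.

Lemma nneseries_real (u : nat -> R) : (forall k, 0 <= u k) ->
  (\sum_(0 <= k <oo) (u k)%:E < +oo)%E ->
  (exists A, forall N, \sum_(0 <= k < N) u k <= A) /\ cvgn (series u).
Proof.
move=> u0 uoo.
have [A uA] : exists A, forall N, \sum_(0 <= k < N) u k <= A.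
  exists (fine (\sum_(0 <= k <oo) (u k)%:E)%E) => N.
  rewrite -lee_fin fineK; last first.
    by rewrite ge0_fin_numE// nneseries_ge0// => k _ _; rewrite lee_fin.
  by rewrite -sumEFin nneseries_lim_ge// => k _ _; rewrite lee_fin.
split; first by exists A.
apply: nondecreasing_is_cvgn; first by apply: nondecreasing_series => k _ _.
by exists A => _ [N _ <-]; exact: uA.
Qed.

Lemma series_tail (u : nat -> R) (e : R) : (forall k, 0 <= u k) ->
  cvgn (series u) -> 0 < e -> exists M, forall N, \sum_(M <= k < N) u k <= e.
Proof.
move=> u0 cu e0.
have nd : nondecreasing_seq (series u) by apply: nondecreasing_series => k _ _.
have /cvgrPdist_lt/(_ e e0)[M _ /(_ M (leqnn _))] := cu.
rewrite ltr_norml => /andP[_ uM]; exists M => N.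
have [NM|MN] := leqP N M; first by rewrite big_geq// ltW.
rewrite -sub_series_geq 1?ltnW// (le_trans _ (ltW uM))// lerD2r.
exact: nondecreasing_cvgn_le.
Qed.

(** By induction on [M]: half of the rate [e] absorbs the last factor, the other half goes to the
    remaining ones. *)
Lemma prod_subexp_fin (u : nat -> R) (M : nat) (e : R) : (forall k, 0 <= u k) ->
  0 < e -> exists2 K, 0 <= K & forall x, 0 <= x ->
    \prod_(0 <= k < M) (1 + x * u k) <= K * expR (e * x).
Proof.
move=> u0; elim: M e => [|M ih] e e0.
  exists 1 => // x x0; rewrite big_nil mul1r -expR0 ler_expR.
  by rewrite mulr_ge0// ltW.
have e2 : 0 < e / 2 by rewrite divr_gt0.
have [K K0 KP] := ih _ e2.
have K'0 : 0 <= 1 + u M / (e / 2) by rewrite addr_ge0// divr_ge0// ltW.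
exists (K * (1 + u M / (e / 2))) => [|x x0]; first exact: mulr_ge0.
rewrite big_nat_recr//=.
have -> : e * x = e / 2 * x + e / 2 * x by field.
rewrite expRD mulrACA; apply: ler_pM; rewrite ?KP//.
- by apply: prodr_ge0 => k _; rewrite addr_ge0// mulr_ge0.
- by rewrite addr_ge0// mulr_ge0.
rewrite (@le_trans _ _ ((1 + u M / (e / 2)) * (1 + e / 2 * x)))//; last first.
  by rewrite ler_wpM2l// expR_ge1Dx.
have -> : (1 + u M / (e / 2)) * (1 + e / 2 * x) =
  1 + x * u M + (u M / (e / 2) + e / 2 * x) by field; rewrite gt_eqF.
by rewrite lerDl addr_ge0// ?divr_ge0 ?mulr_ge0// ltW.
Qed.

(** The product is cut where the tail of the series falls below e/2: finitely many factors form a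
    polynomial in x, and 1 + v <= exp(v) handles the others. *)
Lemma prod_subexp (u : nat -> R) (e : R) : (forall k, 0 <= u k) ->
  cvgn (series u) -> 0 < e -> exists K, forall N x, 0 <= x ->
    \prod_(0 <= k < N) (1 + x * u k) <= K * expR (e * x).
Proof.
move=> u0 cu e0; have e2 : 0 < e / 2 by rewrite divr_gt0.
have [M MP] := series_tail u0 cu e2.
have [K K0 KP] := prod_subexp_fin M u0 e2.
exists K => N x x0.
have G1 k : 1 <= 1 + x * u k by rewrite lerDl mulr_ge0.
have G0 a b : 0 <= \prod_(a <= k < b) (1 + x * u k).
  by apply: prodr_ge0 => k _; rewrite (le_trans _ (G1 k)).
(* Adding factors that are at least 1 avoids a case distinction between N < M and N >= M. *)
apply: (@le_trans _ _ (\prod_(0 <= k < M + N) (1 + x * u k))).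
  rewrite addnC (big_cat_nat _ (leq_addr M N))//= ler_peMr//.
  by elim/big_ind : _ => // a b; exact: mulr_ege1.
have -> : e * x = e / 2 * x + e / 2 * x by field.
rewrite (big_cat_nat _ (leq_addr N M))//= expRD mulrA.
apply: ler_pM; rewrite ?KP//.
apply: (@le_trans _ _ (expR (x * \sum_(M <= k < M + N) u k))); last first.
  by rewrite ler_expR mulrC ler_wpM2r.
rewrite mulr_sumr expR_sum; apply: ler_prod => k _.
by rewrite (le_trans _ (G1 k))//= expR_ge1Dx.
Qed.

Lemma cvg_complex_series (a : nat -> R[i]) (b : nat -> R) :
  (forall k, cmod (a k) <= b k) -> cvgn (series b) ->
  exists l : R[i], series (a : nat -> R[i]^o) @ \oo --> (l : R[i]^o).
Proof.
move=> ab cb.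
have b0 k : 0 <= b k by rewrite (le_trans (cmod_ge0 _) (ab k)).
have cRe : cvgn (series (fun k => complex.Re (a k))).
  apply: normed_cvg; apply: (series_le_cvg _ b0 _ cb) => k //=.
  exact: le_trans (ler_Re_cmod _) (ab k).
have cIm : cvgn (series (fun k => complex.Im (a k))).
  apply: normed_cvg; apply: (series_le_cvg _ b0 _ cb) => k //=.
  exact: le_trans (ler_Im_cmod _) (ab k).
pose l := limn (series (fun k => complex.Re (a k))) +i*
          limn (series (fun k => complex.Im (a k))).
(* The radius [eps] lives in [R[i]]; its positivity includes that its imaginary part is zero. *)
exists l; apply/cvgrPdist_lt => eps; rewrite ltcE /= => /andP[/eqP Ie e0].
have e2 : 0 < complex.Re eps / 2 by rewrite divr_gt0.
have /cvgrPdist_lt/(_ _ e2) hRe := cRe; have /cvgrPdist_lt/(_ _ e2) hIm := cIm.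
near=> N.
have -> : eps = (complex.Re eps)%:C by move: Ie; case: (eps) => x y /= ->.
rewrite -[`|_|]/(cmod _)%:C ltcR (le_lt_trans (cmod_ler_ReIm _))//.
rewrite Re_complexB Im_complexB [complex.Re (series _ _)]Re_sum [complex.Im (series _ _)]Im_sum.
rewrite [ltRHS]splitr ltrD//; near: N.
  exact: hRe.
exact: hIm.
Unshelve. all: by end_near. Qed.

(** Bolzano-Weierstrass, from the compactness of a square in the real plane. *)
Lemma bounded_cluster (w : nat -> R[i]) (r : R) : (forall n, cmod (w n) <= r) ->
  exists z : R[i], forall e N, 0 < e -> exists2 n, (N <= n)%N & cmod (z - w n) < e.
Proof.
move=> wr; pose v n : R * R := (complex.Re (w n), complex.Im (w n)).
have cpt := compact_setX (@segment_compact R (- r) r) (@segment_compact R (- r) r).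
have [|[p q] [_ pq]] := cpt (v @ \oo) _.
  exists 0%N => // n _; split; rewrite /= in_itv/= -ler_norml.
    exact: le_trans (ler_Re_cmod _) (wr n).
  exact: le_trans (ler_Im_cmod _) (wr n).
exists (p +i* q) => e N e0; have e2 : 0 < e / 2 by rewrite divr_gt0.
have [||x [[n Nn <-] [h1 h2]]] := pq (v @` [set n | (N <= n)%N]) (ball (p, q) (e / 2)).
- by exists N => // n Nn; exists n.
- exact: nbhsx_ballx.
exists n => //; rewrite (le_lt_trans (cmod_ler_ReIm _))// Re_complexB Im_complexB.
by rewrite [ltRHS]splitr ltrD.
Qed.

End Series.

(** * Limits of zeros of the partial sums *)

Section LimitOfZeros.
Variables (R : realType) (c : nat -> R) (t : nat -> R[i]).
Hypothesis c_gt0 : forall k, 0 < c k.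
Hypothesis t_neq0 : forall k, t k != 0.
Hypothesis t_infty : cmod (t n) @[n --> \oo] --> +oo.

Local Notation f N z := (\sum_(0 <= k < N) (c k)%:C / (z - t k)).

(** Since |t_n| tends to infinity, all but finitely many poles are at distance at least 1 from
    [w]. *)
Lemma pole_separation (w : R[i]) :
  exists2 d, 0 < d & forall n, t n != w -> d <= cmod (w - t n).
Proof.
have /cvgryPgt/(_ (cmod w + 1)) [N _ hN] := t_infty.
have [d d0 hd] : exists2 d, 0 < d &
    forall n, (n < N)%N -> t n != w -> d <= cmod (w - t n).
  elim: N {hN} => [|N [d d0 hd]]; first by exists 1.
  have [tw|tw] := eqVneq (t N) w.
    exists d => // n; rewrite ltnS leq_eqVlt => /orP[/eqP->|/hd//].
    by rewrite tw eqxx.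
  exists (Num.min d (cmod (w - t N))).
    by rewrite lt_min d0 cmod_gt0 subr_eq0 eq_sym.
  move=> n; rewrite ltnS leq_eqVlt => /orP[/eqP-> _|nN tn].
    by rewrite ge_min lexx orbT.
  by rewrite ge_min hd.
exists (Num.min d 1) => [|n tn]; first by rewrite lt_min d0 ltr01.
rewrite ge_min; have [nN|Nn] := ltnP n N; first by rewrite hd.
apply/orP; right; have := hN n Nn; have := ler_cmodD (t n - w) w.
by rewrite subrK cmodB /=; lra.
Qed.

Lemma cauchy_zero_limit (w : R[i]) :
  (exists A, forall N, \sum_(0 <= k < N) c k / cmod (t k) <= A) ->
  cvgn (series (fun k => c k / cmod (t k))) ->
  (forall e N, 0 < e -> exists n z, [/\ (N <= n)%N,
     forall k, (k < n)%N -> z != t k, f n z = 0 & cmod (w - z) < e]) ->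
  cauchy_zero c t w.
Proof.
move=> [A sumA] cvA wz; have [d d0 dP] := pole_separation w.
have T0 k : 0 < cmod (t k) by rewrite cmod_gt0.
have A0 : 0 < A by rewrite (lt_le_trans _ (sumA 1%N))// big_nat1 divr_gt0.
(* From |t_k| <= |w - t_k| + |w| and |w - t_k| >= d, so that terms near [w] compare with
   c_k/|t_k|. *)
pose K := 1 + cmod w / d.
have K0 : 0 < K by rewrite ltr_wpDr// divr_ge0 ?cmod_ge0// ltW.
have tK k : t k != w -> cmod (t k) <= K * cmod (w - t k).
  move=> tw; have h := dP k tw.
  have : cmod (t k) <= cmod (t k - w) + cmod w by rewrite -{1}(subrK w (t k)) ler_cmodD.
  rewrite cmodB => /le_trans; apply.
  rewrite /K mulrDl mul1r lerD2l mulrAC -mulrA ler_peMr ?cmod_ge0//.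
  by rewrite ler_pdivlMr// mul1r.
have tz k z : t k != w -> cmod (w - z) < d / 2 -> cmod (w - t k) <= 2 * cmod (z - t k).
  move=> tw wz'; have := dP k tw; have := ler_distcmodD z w (t k).
  by move=> h1 h2; lra.
have inv_le (a b B : R) : 0 < a -> 0 < b -> b <= B * a -> a^-1 <= B / b.
  by move=> a0 b0 h; rewrite ler_pdivlMr// mulrC ler_pdivrMr.
have termz k z : t k != w -> cmod (w - z) < d / 2 ->
    cmod ((c k)%:C / (z - t k)) <= 2 * K * (c k / cmod (t k)).
  move=> tw wz'; have h1 := dP k tw; have h2 := tz k z tw wz'; have h3 := tK k tw.
  rewrite cmodM cmodV cmodR gtr0_norm// mulrCA ler_wpM2l ?(ltW (c_gt0 k))//.
  by apply: inv_le => //; nra.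
have wt m : w != t m.
  apply/eqP => wtm.
  (* At a zero z of f_n with n > m, the terms with pole [w] add up to at least c_m/|w - z| in
     modulus and the others to at most 2 K A, so z cannot be this close to [w]. *)
  have e0 : 0 < Num.min (d / 2) (c m / (2 * K * A)).
    by rewrite lt_min !divr_gt0// !mulr_gt0.
  have [n [z [mn zt fz]]] := wz _ m.+1 e0; rewrite lt_min => /andP[z1 z2].
  have z0 : 0 < cmod (w - z) by rewrite cmod_gt0 subr_eq0 wtm eq_sym zt.
  move: fz; rewrite (bigID (fun k => t k == w))/= => /eqP.
  rewrite (eq_bigr (fun k => (c k)%:C / (z - w))); last by move=> k /eqP->.
  rewrite -mulr_suml -rmorph_sum/= addr_eq0 => /eqP/(congr1 (@cmod R)).
  rewrite cmodN cmodM cmodV cmodR (cmodB z) => E.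
  have le1 : c m <= `|\sum_(0 <= k < n | t k == w) c k|.
    rewrite (le_trans _ (ler_norm _))// big_mkord.
    rewrite (bigD1 (Ordinal mn)) ?wtm//= lerDl.
    by apply: sumr_ge0 => k _; exact: ltW.
  have le2 : cmod (\sum_(0 <= k < n | t k != w) (c k)%:C / (z - t k)) <= 2 * K * A.
    rewrite (le_trans (cmod_sum _ _ _))//.
    rewrite (@le_trans _ _ (\sum_(0 <= k < n | t k != w) 2 * K * (c k / cmod (t k))))//.
      by apply: ler_sum => k tw; exact: termz.
    rewrite -mulr_sumr ler_wpM2l ?mulr_ge0 ?(ltW K0)//.
    rewrite (le_trans _ (sumA n))// [leRHS](bigID (fun k => t k == w))/= lerDr.
    by apply: sumr_ge0 => k _; rewrite divr_ge0// ltW.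
  move: le2; rewrite -E ler_pdivrMr// => le2.
  have := le_trans le1 le2; rewrite leNgt => /negP; apply.
  by rewrite mulrC -ltr_pdivlMr// !mulr_gt0.
have wt' k : t k != w by rewrite eq_sym.
have [l cl] : exists l : R[i], cauchy_series c t w @ \oo --> (l : R[i]^o).
  apply: (@cvg_complex_series _ _ (fun k => 2 * K * (c k / cmod (t k)))) => [k|].
    by apply: termz => //; rewrite subrr cmod0 divr_gt0.
  have -> : series (fun k => 2 * K * (c k / cmod (t k))) =
      (fun n => (2 * K) * series (fun k => c k / cmod (t k)) n).
    by apply/funext => n; rewrite /series/= mulr_sumr.
  by apply: is_cvgMr.
have l0 : l = 0.
  apply/eqP; apply/negPn; rewrite -cmod_gt0; apply/negP => l0.
  have l2 : 0 < cmod l / 2 by rewrite divr_gt0.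
  have /cvgrPdist_lt/(_ (cmod l / 2)%:C) := cl.
  rewrite ltcR => /(_ l2)[N _ hN].
  (* A Lipschitz constant, independent of n, for f_n between [w] and points at distance less than
     d/2: at a zero z of f_n, |f_n(w)| <= B |w - z|. *)
  pose B := 2 / d * (2 * K) * A.
  have B0 : 0 < B by rewrite !mulr_gt0// invr_gt0.
  have e0 : 0 < Num.min (d / 2) (cmod l / 2 / B) by rewrite lt_min !divr_gt0.
  have [n [z [Nn zt fz]]] := wz _ N e0; rewrite lt_min => /andP[z1 z2].
  have := hN n Nn; rewrite /= -[`|_|]/(cmod _)%:C ltcR.
  have fB : cmod (f n w) <= cmod (w - z) * B.
    have -> : f n w = f n w - f n z by rewrite fz subr0.
    rewrite -sumrB (le_trans (cmod_sum _ _ _))//.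
    rewrite /B mulrA mulrA.
    apply: (@le_trans _ _ (\sum_(0 <= k < n)
      cmod (w - z) * (2 / d) * (2 * K) * (c k / cmod (t k)))); last first.
      rewrite -mulr_sumr ler_wpM2l// !mulr_ge0 ?cmod_ge0 ?invr_ge0//; exact: ltW.
    rewrite big_nat [leRHS]big_nat; apply: ler_sum => k /andP[_ kn].
    have wk : w - t k != 0 by rewrite subr_eq0.
    have zk : z - t k != 0 by rewrite subr_eq0 zt.
    have -> : (c k)%:C / (w - t k) - (c k)%:C / (z - t k) =
      - ((w - z) / (w - t k) * ((c k)%:C / (z - t k))).
      by field; rewrite wk zk.
    rewrite cmodN cmodM -mulrA; apply: ler_pM; rewrite ?cmod_ge0 ?termz//.
    rewrite cmodM cmodV ler_wpM2l ?cmod_ge0//.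
    by apply: inv_le => //; rewrite ?cmod_gt0//; have := dP k (wt' k); lra.
  have zB : cmod (w - z) * B < cmod l / 2 by rewrite -ltr_pdivlMr.
  have := ler_distcmodD (f n w) l 0; rewrite !subr0 => h1 h2; lra.
split=> //; first by apply/cvg_ex; exists l.
rewrite -l0; apply: cvg_lim cl; exact: norm_hausdorff.
Qed.

End LimitOfZeros.

(** * Existence of a zero of the full series *)

Unset Implicit Arguments.
Set Strict Implicit.

Theorem theorem12 (R : realType) (t : nat -> R[i]) (c : nat -> R)
  (t_neq0 : forall n, t n != 0)
  (t_infty : cmod (t n) @[n --> \oo] --> +oo)
  (c_gt0 : forall n, 0 < c n)
  (t_arg : forall n, `|Arg (t n)| < pi / 4)
  (sum_ct : (\sum_(0 <= n <oo) (c n / cmod (t n))%:E < +oo)%E)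
  (sum_t : (\sum_(0 <= n <oo) (1 / cmod (t n))%:E < +oo)%E) :
  exists z : R[i], cauchy_zero c t z.
Proof.
have t_wedge k : wedge (t k) by exact: wedge_Arg.
have [[A sumA] cvg_ct] : (exists A, forall N, \sum_(0 <= k < N) c k / cmod (t k) <= A) /\
    cvgn (series (fun k => c k / cmod (t k))).
  by apply: nneseries_real sum_ct => k; rewrite divr_ge0 ?cmod_ge0// ltW.
have u0 k : 0 <= (cmod (t k))^-1 by rewrite invr_ge0 cmod_ge0.
have cvg_t : cvgn (series (fun k => (cmod (t k))^-1)).
  suff: (\sum_(0 <= k <oo) ((cmod (t k))^-1)%:E < +oo)%E by case/nneseries_real.
  by under eq_eseriesr do rewrite -div1r.
(* Two distinct poles exist because the moduli are unbounded. *)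
have [m tm] : exists m, t 0%N != t m.
  have /cvgryPgt/(_ (cmod (t 0%N)))[m _ /(_ m (leqnn _)) tm] := t_infty.
  by exists m; apply: contraTneq tm => <-; rewrite ltxx.
have [r rP] := bounded_zeros c_gt0 t_wedge tm sumA (fun e => prod_subexp u0 cvg_t).
(* The shift by m + 1 ensures that each partial sum contains both distinct poles, as the common disc
   requires. *)
have /choice[w wP] N : exists w, [/\ forall k, (k < N + m.+1)%N -> w != t k,
    \sum_(0 <= k < N + m.+1) (c k)%:C / (w - t k) = 0 & cmod w <= r].
  by apply: rP; rewrite ltn_addl.
have [|z zP] := @bounded_cluster _ w r; first by move=> N; have [] := wP N.
exists z; apply: cauchy_zero_limit => //; first by exists A.
move=> e N e0; have [n Nn zn] := zP e N e0; have [w1 w2 _] := wP n.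
by exists (n + m.+1)%N, (w n); split=> //; rewrite (leq_trans Nn)// leq_addr.
Qed.
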